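(* For the random graph process $G(t)$ on $n$ vertices with (arbitrary nonnegative) edge rates $a_{ij}$, $$\mathrm{E}(T_n(k))=\sum_{j=k+1}^n\ \sum_{B\in \mathrm{Clique}_j}\frac{\tau(j,k)}{[\mathcal{E}_n\setminus B]},\qquad \mathrm{E}(L_n(k))=\sum_{j=k+1}^n\ \sum_{B\in \mathrm{Clique}_j}\frac{\lambda(j,k)}{[\mathcal{E}_n\setminus B]},$$ where $\tau(j,k)=\sum_{i=k+1}^j s(j,i)$ and $\lambda(j,k)=\sum_{i=k+1}^j (i-k)\,s(j,i)$ are sums of signed Stirling numbers of the first kind $s(j,i)$.
   Context: Let $\mathcal{E}_n$ be the edge set of the complete graph $K_n$ on vertex set $\{1,\dots,n\}$, with $e_{ij}$ the edge joining $i$ and $j$. Each edge $e_{ij}$ is given a rate $a_{ij}\ge 0$ and appears at a random time $t_{ij}$; the times $t_{ij}$ are independent and exponentially distributed, so that the probability that $e_{ij}$ has not appeared at time $t$ is $\exp(-a_{ij}t)$. The random graph $G(t)$ is the graph on $\{1,\dots,n\}$ whose edges are those that have appeared by time $t$; it is edgeless at $t=0$. $T_n(k)$ is the time at which $G(t)$ becomes a graph with $k$ connected components, i.e. at which the number of components has gone down to $k$. $L_n(k)$ is the length of the minimal spanning $k$-forest, i.e. the minimum, over all spanning forests of $K_n$ with exactly $k$ connected components (isolated vertices count as components), of the sum of the appearance times $t_{ij}$ of the edges of the forest. For $A\subseteq\mathcal{E}_n$, $[A]=\sum_{e_{ij}\in A}a_{ij}$. $\mathrm{Clique}_j$ is the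 set of all edge sets $B\subseteq\mathcal{E}_n$ obtained from a partition of $\{1,\dots,n\}$ into exactly $j$ nonempty (unordered) parts by letting $B$ consist of all edges of $K_n$ having both endpoints in the same part. The numbers $s(j,i)$ are the signed Stirling numbers of the first kind: $s(j,i)=(-1)^{j+i}$ times the number of permutations of $j$ elements with exactly $i$ cycles, equivalently $\sum_{i} s(j,i)x^i=x(x-1)\cdots(x-j+1)$. *)

(* Defs.v *)
From HB Require Import structures.
From mathcomp Require Import all_boot all_order all_algebra all_fingroup.
From mathcomp Require Import all_classical all_reals all_analysis measurable_realfun.

Set Implicit Arguments.
Unset Strict Implicit.
Unset Printing Implicit Defensive.

Import Order.TTheory GRing.Theory Num.Theory.

Local Open Scope ring_scope.

(* The vertex set {1, ..., n} is represented by 'I_n = {0, ..., n-1}, and the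
   edges of K_n are its two-element subsets. *)
Definition edge (n : nat) := {e : {set 'I_n} | #|e| == 2%N}.

Definition adj (n : nat) (A : {set edge n}) : rel 'I_n :=
  fun i j => [exists e in A, val e == [set i; j]%SET].

Definition ncomp (n : nat) (A : {set edge n}) : nat := n_comp (adj A) 'I_n.

Definition acyclic (n : nat) (A : {set edge n}) : Prop :=
  forall c : seq 'I_n, (2 < size c)%N -> ~ ucycle (adj A) c.

Definition spanning_forest (n k : nat) (F : {set edge n}) : Prop :=
  acyclic F /\ ncomp F = k.

Definition weight (R : realType) (n : nat) (a : edge n -> R)
  (A : {set edge n}) : R := \sum_(e in A) a e.

Definition clique_edges (n : nat) (Q : {set {set 'I_n}}) : {set edge n} :=
  [set e : edge n | [exists V in Q, val e \subset V]]%SET.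

Definition Clique (n j : nat) : {set {set edge n}} :=
  [set clique_edges Q | Q : {set {set 'I_n}}
                      & finset.partition Q [set: 'I_n]%SET && (#|Q| == j)]%SET.

Definition stirling1 (j i : nat) : int :=
  (-1) ^+ (j + i) * (#|[set s : 'S_j | #|porbits s| == i]%SET|)%:Z.

Definition tau (j k : nat) : int := \sum_(k.+1 <= i < j.+1) stirling1 j i.

Definition lambda (j k : nat) : int :=
  \sum_(k.+1 <= i < j.+1) (i%:Z - k%:Z) * stirling1 j i.

Definition mutually_independent (d : measure_display) (Omega : measurableType d)
    (R : realType) (P : probability Omega R) (I : finType)
    (X : I -> Omega -> \bar R) : Prop :=
  forall (J : {set I}) (A : I -> set (\bar R)),
    (forall i, measurable (A i)) ->
    P (\bigcap_(i in [set` J]) (X i @^-1` A i))%classic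
      = (\prod_(i in J) P (X i @^-1` A i)%classic)%E.

(* Appearance times take values in the extended reals: an edge of rate 0 almost
   surely never appears, i.e. its time is +oo.  The tail at s = 0 forces the
   times to be almost surely positive. *)
Definition exponential_time (d : measure_display) (Omega : measurableType d)
    (R : realType) (P : probability Omega R) (r : R)
    (X : Omega -> \bar R) : Prop :=
  measurable_fun [set: Omega]%classic X /\
  forall s : R, 0 <= s ->
    P [set w | (s%:E < X w)%E]%classic = (expR (- (r * s)))%:E.

Section Process.
Variables (R : realType) (n : nat) (Omega : Type) (t : edge n -> Omega -> \bar R).

Definition G (s : R) (w : Omega) : {set edge n} :=
  [set e | (t e w <= s%:E)%E]%SET.

(* Equals +oo when G never has as few as k components. *)
Definition T (k : nat) (w : Omega) : \bar R :=
  ereal_inf [set s%:E | s in [set s : R | 0 <= s /\ (ncomp (G s w) <= k)%N]]%classic.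

Definition L (k : nat) (w : Omega) : \bar R :=
  \big[mine/+oo%E]_(F : {set edge n} | `[< spanning_forest k F >])
    (\sum_(e in F) t e w)%E.

End Process.

(* Main.v *)
Require Import Defs.
From HB Require Import structures.
From mathcomp Require Import all_boot all_order all_algebra all_fingroup.
From mathcomp Require Import all_classical all_reals all_analysis measurable_realfun.
From mathcomp Require Import zify.

Set Implicit Arguments.
Unset Strict Implicit.
Unset Printing Implicit Defensive.

Import Order.TTheory GRing.Theory Num.Theory.

Local Open Scope ring_scope.

(** Both expectations reduce to means of minima of independent exponential
times, through an integral over time and an inversion over set partitions.

The integral over time. The time [T] is the total duration for which [G] has
more than [k] components, so it is the integral over [s >= 0] of
[k < ncomp (G s)]. The total time of a forest [F] is the integral of the
number of edges of [F] that are absent from [G s]. When [F] has [k]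
components, that number is at least the excess [ncomp (G s) - k], because
adding an edge to [G s] merges at most two components ([ncomp_leqD]). The
forest built by adding edges in their order of appearance, and stopping at
[k] components, attains the bound at every time ([greedy_forest]). Hence [L]
is the integral of the excess ([T_integral], [L_integral]).

The inversion. Both integrands are [phi (ncomp (G s))] for a function [phi]
of the number of components that vanishes up to [k]. For every edge set [A]
and every [phi], [phi (ncomp A)] is the sum, over the clique edge sets [B]
that contain [A], of the integers [\sum_i s(j, i) phi(i)], where [j] is the
number of parts of [B] ([sum_Clique_stirling1]). For [phi(i) = m ^ i] this is
a count: there are [m ^ ncomp A] maps from the vertices to an [m]-element set
that are constant on the components of [A]; sort them by the set [B] of the
edges whose ends have equal values. A set [B] with [j] parts comes from
[m ^_ j] maps, and [m ^_ j = \sum_i s(j, i) m ^ i]. As [m] is arbitrary, the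
identity holds between polynomials, hence for all [phi].

For [A = G s], the condition that [B] contains [A] says that [s] precedes the
first appearance of an edge outside [B]. Integrating over [s] turns [T] and
[L] into linear combinations of these first times ([integral_profile]). The
first time outside [B] is exponential, with rate the total rate of the edges
outside [B], so its mean is the inverse of that rate. The coefficients are
[tau] and [lambda], and they vanish when [B] has at most [k] parts.

If the rate outside some [B] with more than [k] parts is zero, then almost
surely no edge outside [B] ever appears. The graph then keeps more than [k]
components, and every spanning [k]-forest uses an edge that never appears. *)

(** * Counting functions through their kernels *)

Section Factoring.
Variables (V U T : finType) (p : V -> U).

Lemma factoring_codomP (w : {u | u \in p @: V}) : exists x, p x == val w.
Proof. by case: w => u /= /imsetP[x _ ->]; exists x. Qed.

(** The codomain is cut down to the image of [p], so that [p] becomes surjective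
and a map that factors through [p] does so in exactly one way. *)
Definition factor_through (g : {ffun {u | u \in p @: V} -> T}) : {ffun V -> T} :=
  [ffun x => g (exist _ (p x) (imset_f p (isT : x \in V)))].

Lemma factor_through_inj : injective factor_through.
Proof.
move=> g h gh; apply/ffunP => w; have [x /eqP pxw] := factoring_codomP w.
have -> : w = exist _ (p x) (imset_f p (isT : x \in V)) by apply: val_inj.
by move/ffunP/(_ x): gh; rewrite !ffunE.
Qed.

Lemma factor_throughP (f : {ffun V -> T}) :
  (forall x y, p x = p y -> f x = f y) -> exists g, f = factor_through g.
Proof.
move=> pf; exists [ffun w => f (xchoose (factoring_codomP w))].
apply/ffunP => x; rewrite !ffunE; apply: pf.
by rewrite (eqP (xchooseP (factoring_codomP _))).
Qed.

Lemma factor_through_eq g x y : p x = p y -> factor_through g x = factor_through g y.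
Proof. by move=> pxy; rewrite !ffunE; congr (g _); apply: val_inj. Qed.

Lemma card_factoring :
  #|[set f : {ffun V -> T} | [forall x, forall y, (p x == p y) ==> (f x == f y)]]%SET|
    = (#|T| ^ #|p @: V|)%N.
Proof.
rewrite -[#|p @: V|](card_sig [in p @: V]) /= -card_ffun -cardsT.
rewrite -(card_imset _ factor_through_inj); apply: eq_card => f; rewrite inE.
apply/idP/imsetP => [/forallP pf|[g _ ->]].
  have [|g ->] := @factor_throughP f; last by exists g; rewrite ?inE.
  by move=> x y /eqP pxy; have /forallP/(_ y)/implyP/(_ pxy)/eqP := pf x.
by apply/forallP => x; apply/forallP => y; apply/implyP => /eqP /factor_through_eq ->.
Qed.

Lemma card_factoring_inj :
  #|[set f : {ffun V -> T} | [forall x, forall y, (p x == p y) == (f x == f y)]]%SET|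
    = (#|T| ^_ #|p @: V|)%N.
Proof.
rewrite -[#|p @: V|](card_sig [in p @: V]) /= -card_inj_ffuns.
rewrite -(card_imset _ factor_through_inj); apply: eq_card => f; rewrite inE.
apply/idP/imsetP => [/forallP pf|[g]].
  have kf x y : (p x == p y) = (f x == f y) by have /forallP/(_ y)/eqP := pf x.
  have [|g fg] := @factor_throughP f.
    by move=> x y /eqP; rewrite kf => /eqP.
  exists g => //; rewrite inE; apply/injectiveP => u v.
  have [x /eqP ux] := factoring_codomP u; have [y /eqP vy] := factoring_codomP v.
  have -> : u = exist _ (p x) (imset_f p (isT : x \in V)) by apply: val_inj.
  have -> : v = exist _ (p y) (imset_f p (isT : y \in V)) by apply: val_inj.
  move=> guv; apply: val_inj => /=; apply/eqP; rewrite kf fg !ffunE.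
  by apply/eqP.
rewrite inE => /injectiveP g_inj ->{f}.
apply/forallP => x; apply/forallP => y; rewrite !ffunE (inj_eq g_inj).
by apply/eqP.
Qed.

End Factoring.

Lemma leq_card_imset_kernel (V U W : finType) (f : V -> U) (g : V -> W) :
  (forall x y, g x = g y -> f x = f y) -> (#|f @: V| <= #|g @: V|)%N.
Proof.
move=> gf; have [x0 _|V0] := pickP V; last first.
  by rewrite [X in (X <= _)%N]eq_card0// => u; apply/imsetP => -[x _ _]; have := V0 x.
pose r w := odflt x0 [pick x | g x == w].
apply: (@leq_trans #|[set f (r w) | w in g @: V]%SET|); last exact: leq_imset_card.
apply/subset_leq_card/fintype.subsetP => _ /imsetP[x _ ->].
apply/imsetP; exists (g x); first exact: imset_f.
by apply: gf; rewrite /r; case: pickP => [y /eqP//|/(_ x)]; rewrite eqxx.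
Qed.

(** Lets a partition be replaced by any map with the same kernel: roots of
components, blocks and values of a function all count the same classes. *)
Lemma eq_card_imset_kernel (V U W : finType) (f : V -> U) (g : V -> W) :
  (forall x y, (f x == f y) = (g x == g y)) -> #|f @: V| = #|g @: V|.
Proof.
move=> fg; apply/eqP; rewrite eqn_leq.
apply/andP; split; apply: leq_card_imset_kernel => x y /eqP.
  by rewrite -fg => /eqP.
by rewrite fg => /eqP.
Qed.

(** * Stirling numbers and falling factorials *)

(** Invariance under [s] means being constant on the cycles of [s]. *)
Lemma card_perm_invariant (V T : finType) (s : {perm V}) :
  #|[set f : {ffun V -> T} | [forall x, f (s x) == f x]]%SET| = (#|T| ^ #|porbits s|)%N.
Proof.
rewrite /porbits -(card_factoring T (porbit s)); apply: eq_card => f; rewrite !inE.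
apply/forallP/forallP => [fs x|fs x]; last first.
  have /forallP/(_ x)/implyP := fs (s x); apply.
  by rewrite eq_porbit_mem; have := mem_porbit s 1 x; rewrite expg1.
apply/forallP => y; apply/implyP; rewrite eq_porbit_mem => /porbitP[i ->].
apply/eqP; elim: i => [|i IH]; first by rewrite expg0 perm1.
by rewrite expgSr permM (eqP (fs _)).
Qed.

(** If [f] takes the same value at [x] and [y], composing with the transposition
of [x] and [y] is a sign-reversing bijection of the permutations that leave
[f] invariant, so their signs cancel. If [f] is injective, only the identity
leaves it invariant. *)
Lemma sum_sign_invariant (V : finType) (T : eqType) (f : V -> T) :
  \sum_(s : {perm V} | [forall x, f (s x) == f x]) (-1) ^+ odd_perm s
    = (injectiveb f)%:R :> int.
Proof.
have [f_inj|] := boolP (injectiveb f).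
  rewrite (big_pred1 1%g) ?odd_perm1// => s; apply/forallP/eqP => [fs|-> x].
    by apply/permP => x; rewrite perm1; apply: (injectiveP _ f_inj); apply/eqP.
  by rewrite perm1.
move=> /injectivePn[x [y xy fxy]].
have f_tperm z : f (tperm x y z) = f z by case: tpermP => [->|->|].
set S := (X in X = _).
have : S = - S.
  rewrite {1}/S (reindex_inj (mulgI (tperm x y))) /= /S -sumrN.
  apply: eq_big => [s|s _].
    apply/forallP/forallP => fs z; last by rewrite permM (eqP (fs _)) f_tperm.
    by have := fs (tperm x y z); rewrite permM tpermK f_tperm.
  by rewrite odd_permM odd_tperm xy /=; case: (odd_perm s); rewrite ?opprK.
by move/eqP; rewrite -subr_eq0 opprK -mulr2n mulrn_eq0 /= => /eqP.
Qed.

(** The parity of a permutation of [j] points with [i] cycles is that of [j + i]. *)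
Lemma stirling1E j i :
  stirling1 j i = \sum_(s : 'S_j | #|porbits s| == i) (-1) ^+ odd_perm s.
Proof.
rewrite /stirling1 (eq_bigr (fun=> (-1) ^+ (j + i))).
  by rewrite sumr_const cardsE -mulr_natr natz.
move=> s /eqP <-; rewrite -[in RHS]signr_odd; congr (_ ^+ _).
by rewrite /odd_perm card_ord oddD.
Qed.

Lemma sum_stirling1_perm j (phi : nat -> int) :
  \sum_(i < j.+1) stirling1 j i * phi i
    = \sum_(s : 'S_j) (-1) ^+ odd_perm s * phi #|porbits s|.
Proof.
under eq_bigr do rewrite stirling1E mulr_suml.
rewrite (exchange_big_dep predT) //=; apply: eq_bigr => s _.
have lt_orbits : (#|porbits s| < j.+1)%N.
  by rewrite ltnS (leq_trans (leq_imset_card _ _))// card_ord.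
by rewrite (big_pred1 (Ordinal lt_orbits)) //.
Qed.

(** Both sides count injections from [j] points to [m] values: on the left,
[m ^ i] counts the maps invariant under a permutation with [i] cycles, and
exchanging the two sums leaves a signed count of the permutations that fix a
given map. *)
Lemma sum_stirling1_exp j m :
  \sum_(i < j.+1) stirling1 j i * (m%:R) ^+ i = (m ^_ j)%:R :> int.
Proof.
rewrite (sum_stirling1_perm j (fun i => m%:R ^+ i)).
transitivity (\sum_(f : {ffun 'I_j -> 'I_m}) (injectiveb f)%:R : int).
  under [RHS]eq_bigr do rewrite -sum_sign_invariant.
  rewrite (exchange_big_dep predT) //=; apply: eq_bigr => s _.
  rewrite sumr_const -natrX -[m in LHS]card_ord -card_perm_invariant mulr_natr.
  by congr (_ *+ _); apply: eq_card => f; rewrite inE.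
rewrite -natr_sum; congr (_%:R); by rewrite -big_mkcond sum1dep_card card_inj_ffuns !card_ord.
Qed.

(** * Components and clique edge sets *)

Section Graphs.
Variable n : nat.
Implicit Types (A B F : {set edge n}) (e : edge n) (x y : 'I_n).

Lemma edgeP e : exists x y, x != y /\ val e = [set x; y]%SET.
Proof. exact/cards2P/(valP e). Qed.

Lemma edge_of_proof x y : x != y -> #|[set x; y]%SET| == 2%N.
Proof. by move=> xy; rewrite cards2 xy. Qed.

Definition edge_of x y (xy : x != y) : edge n :=
  exist (fun e : {set 'I_n} => #|e| == 2%N) _ (edge_of_proof xy).

Lemma adjP A x y :
  reflect (exists e, e \in A /\ val e = [set x; y]%SET) (adj A x y).
Proof.
apply: (iffP existsP) => [[e /andP[eA /eqP ee]]|[e [eA ee]]]; exists e; first by split.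
by rewrite eA ee eqxx.
Qed.

Lemma adj_sym A : symmetric (adj A).
Proof. by move=> x y; rewrite /adj finset.setUC. Qed.

Lemma adj_neq A x y : adj A x y -> x != y.
Proof.
move=> /adjP[e [_ ee]]; apply/negP => /eqP xy.
by have := valP e; rewrite ee xy finset.setUid cards1.
Qed.

Lemma connect_adj_sym A : connect_sym (adj A).
Proof. by apply: sym_connect_sym; apply: adj_sym. Qed.

Lemma sub_adj A B : A \subset B -> subrel (adj A) (adj B).
Proof.
by move=> AB x y /adjP[e [eA ee]]; apply/adjP; exists e; split=> //; apply: (fintype.subsetP AB).
Qed.

Lemma sub_connect_adj A B : A \subset B -> subrel (connect (adj A)) (connect (adj B)).
Proof.
move=> AB; apply: connect_sub => x y xy; apply: connect1; exact: sub_adj AB x y xy.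
Qed.

(** Counting components as values of a map makes [ncomp] comparable with the
cardinals of images of other maps with the same kernel, or a coarser one. *)
Lemma ncompE A : ncomp A = #|fingraph.root (adj A) @: 'I_n|.
Proof.
apply: eq_card => x; rewrite !inE andbT; apply/idP/imsetP => [/eqP xr|[y _ ->]].
  by exists x.
by apply: roots_root; apply: connect_adj_sym.
Qed.

Lemma ncomp_leq_kernel (U : finType) A (p : 'I_n -> U) :
  (forall x y, p x = p y -> connect (adj A) x y) -> (ncomp A <= #|p @: 'I_n|)%N.
Proof.
move=> pA; rewrite ncompE; apply: leq_card_imset_kernel => x y /pA.
by move/(fingraph.rootP (connect_adj_sym A)).
Qed.

Lemma ncomp_kernel (U : finType) A (p : 'I_n -> U) :
  (forall x y, connect (adj A) x y = (p x == p y)) -> ncomp A = #|p @: 'I_n|.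
Proof.
move=> pA; rewrite ncompE; apply: eq_card_imset_kernel => x y.
by rewrite (root_connect (connect_adj_sym A)) pA.
Qed.

Lemma leq_ncomp A B : A \subset B -> (ncomp B <= ncomp A)%N.
Proof.
move=> AB; rewrite [ncomp A]ncompE; apply: ncomp_leq_kernel => x y.
by move/(fingraph.rootP (connect_adj_sym A)); apply: sub_connect_adj.
Qed.

Section Level.
Variable T : eqType.
Implicit Type f : 'I_n -> T.

(** The clique edge sets are exactly the sets of this form, and maps are easier
to count than set partitions. *)
Definition level_edges f : {set edge n} :=
  [set e : edge n | [forall x in val e, forall y in val e, f x == f y]]%SET.

Lemma mem_level_edges f e x y :
  val e = [set x; y]%SET -> (e \in level_edges f) = (f x == f y).
Proof.
move=> ee; rewrite inE ee; apply/forall_inP/eqP => [fxy|fxy u].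
  have /forall_inP/(_ y) := fxy x (set21 _ _).
  by rewrite set22 => /(_ isT)/eqP.
rewrite !inE => /orP[]/eqP->; apply/forall_inP => v;
  by rewrite !inE => /orP[]/eqP->; rewrite ?fxy.
Qed.

Lemma level_edges_of f x y (xy : x != y) : (edge_of xy \in level_edges f) = (f x == f y).
Proof. exact: mem_level_edges. Qed.

Lemma adj_level_edges f x y : adj (level_edges f) x y = (x != y) && (f x == f y).
Proof.
apply/idP/andP => [xy|[xy fxy]]; last first.
  by apply/adjP; exists (edge_of xy); rewrite level_edges_of.
split; first exact: adj_neq xy.
by have /adjP[e [ef /mem_level_edges<-]] := xy.
Qed.

Lemma connect_level_edges f x y : connect (adj (level_edges f)) x y = (f x == f y).
Proof.
apply/idP/idP => [/connectP[s]|fxy].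
  elim: s x => /= [x _ ->//|z s IH x /andP[]].
  by rewrite adj_level_edges => /andP[_ /eqP->]; apply: IH.
have [->|xy] := eqVneq x y; first exact: connect0.
by apply: connect1; rewrite adj_level_edges xy.
Qed.

Lemma sub_level_edges A f :
  (A \subset level_edges f)
    = [forall x, forall y, (fingraph.root (adj A) x == fingraph.root (adj A) y) ==> (f x == f y)].
Proof.
apply/idP/forallP => [Af x|Af].
  apply/forallP => y; apply/implyP; rewrite (root_connect (connect_adj_sym A)).
  by move/(sub_connect_adj Af); rewrite connect_level_edges.
apply/fintype.subsetP => e eA; have [x [y [xy ee]]] := edgeP e.
rewrite (mem_level_edges _ ee); have /forallP/(_ y)/implyP := Af x; apply.
rewrite (root_connect (connect_adj_sym A)) connect1//.
by apply/adjP; exists e.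
Qed.

End Level.

Lemma eq_level_edges (T U : eqType) (f : 'I_n -> T) (g : 'I_n -> U) :
  (level_edges f == level_edges g) = [forall x, forall y, (f x == f y) == (g x == g y)].
Proof.
apply/eqP/forallP => [fg x|fg].
  by apply/forallP => y; rewrite -!connect_level_edges fg.
apply/setP => e; have [x [y [xy ee]]] := edgeP e.
by rewrite !(mem_level_edges _ ee); have /forallP/(_ y)/eqP := fg x.
Qed.

(** The partition [Q] enters through the map that sends a vertex to its block. *)
Lemma clique_edges_pblock (Q : {set {set 'I_n}}) :
  finset.partition Q [set: 'I_n]%SET -> clique_edges Q = level_edges (finset.pblock Q).
Proof.
case/and3P => /eqP covQ trivQ _; apply/setP => e; have [x [y [xy ee]]] := edgeP e.
have cov z : z \in finset.cover Q by rewrite covQ inE.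
rewrite (mem_level_edges _ ee) inE ee; apply/existsP/eqP => [[W /andP[WQ]]|Qxy].
  rewrite finset.subUset !finset.sub1set => /andP[xW yW].
  by rewrite (def_pblock trivQ WQ xW) (def_pblock trivQ WQ yW).
exists (finset.pblock Q x); rewrite pblock_mem//= finset.subUset !finset.sub1set.
by rewrite mem_pblock cov/= Qxy mem_pblock.
Qed.

Lemma imset_pblock (Q : {set {set 'I_n}}) :
  finset.partition Q [set: 'I_n]%SET -> finset.pblock Q @: 'I_n = Q.
Proof.
case/and3P => /eqP covQ trivQ Q0; apply/setP => W; apply/imsetP/idP => [[x _ ->]|WQ].
  by rewrite pblock_mem// covQ inE.
have [x xW] : exists x, x \in W by apply/set0Pn/(memPn Q0).
by exists x; rewrite ?(def_pblock trivQ WQ xW).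
Qed.

Lemma CliqueP j B :
  B \in Clique n j -> exists2 f : 'I_n -> {set 'I_n}, B = level_edges f & #|f @: 'I_n| = j.
Proof.
move=> /imsetP[Q]; rewrite inE => /andP[partQ /eqP<-] ->.
by exists (finset.pblock Q); [exact: clique_edges_pblock|rewrite imset_pblock].
Qed.

Lemma level_edges_Clique (T : finType) (f : 'I_n -> T) j :
  (level_edges f \in Clique n j) = (#|f @: 'I_n| == j).
Proof.
apply/idP/eqP => [/CliqueP[g /eqP fg <-]|<-].
  apply: eq_card_imset_kernel => x y.
  by move: fg; rewrite eq_level_edges => /forallP/(_ x)/forallP/(_ y)/eqP.
set Q := preim_partition f [set: 'I_n]%SET.
have partQ : finset.partition Q [set: 'I_n]%SET by exact: preim_partitionP.
have Qf x y : (finset.pblock Q x == finset.pblock Q y) = (f x == f y).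
  have [/eqP covQ trivQ _] := and3P partQ.
  rewrite eq_pblock ?covQ ?inE// pblock_equivalence_partition ?inE//.
  by split=> // /eqP->.
apply/imsetP; exists Q; last first.
  by rewrite clique_edges_pblock//; apply/eqP; rewrite eq_level_edges;
    apply/forallP => x; apply/forallP => y; rewrite Qf.
by rewrite inE partQ -{1}(imset_pblock partQ) (eq_card_imset_kernel Qf) eqxx.
Qed.

Lemma ncomp_Clique j B : B \in Clique n j -> ncomp B = j.
Proof.
by move=> /CliqueP[f -> <-]; apply: ncomp_kernel => x y; rewrite connect_level_edges.
Qed.

(** Both sides count the maps to an [m]-element set that are constant on the
components of [A]; the left side sorts them by the edges whose ends have
equal values. *)
Lemma sum_Clique_ffact A m :
  (\sum_(j < n.+1) \sum_(B in Clique n j | A \subset B) m ^_ j = m ^ ncomp A)%N.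
Proof.
rewrite -[m in RHS]card_ord ncompE -card_factoring -sum1_card.
transitivity (\sum_(f : {ffun 'I_n -> 'I_m} | A \subset level_edges f) 1)%N; last first.
  by apply: eq_bigl => f; rewrite inE sub_level_edges.
transitivity (\sum_(j < n.+1) \sum_(B in Clique n j | A \subset B)
    \sum_(f : {ffun 'I_n -> 'I_m} | level_edges f == B) 1)%N.
  apply: eq_bigr => j _; apply: eq_bigr => B /andP[/CliqueP[p -> <-] _].
  rewrite -[m in LHS]card_ord -card_factoring_inj -sum1_card; apply: eq_bigl => f.
  rewrite inE eq_level_edges; apply: eq_forallb => x; apply: eq_forallb => y.
  by rewrite eq_sym.
have lt_im (f : {ffun 'I_n -> 'I_m}) : (#|f @: 'I_n| < n.+1)%N.
  by rewrite ltnS (leq_trans (leq_imset_card _ _))// card_ord.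
rewrite (partition_big (fun f : {ffun 'I_n -> 'I_m} => Ordinal (lt_im f)) predT)//=.
apply: eq_bigr => j _.
rewrite [RHS](partition_big (fun f : {ffun 'I_n -> 'I_m} => level_edges f)
  (fun B => (B \in Clique n j) && (A \subset B)))/=; last first.
  by move=> f /andP[-> /eqP<-]; rewrite level_edges_Clique eqxx.
apply: eq_bigr => B /andP[BC AB]; apply: eq_bigl => f.
have [fB|] := eqVneq; last by rewrite andbF.
rewrite andbT fB AB; apply/esym/eqP/val_inj => /=; apply/eqP.
by rewrite -level_edges_Clique fB.
Qed.

End Graphs.

(** * Stirling inversion over the clique edge sets *)

Lemma poly_eq_on_nat (R : numDomainType) (p q : {poly R}) :
  (forall m : nat, p.[m%:R] = q.[m%:R]) -> p = q.
Proof.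
move=> pq; apply/eqP; rewrite -subr_eq0; apply/negPn/negP => pq_neq0.
have := max_poly_roots (rs := [seq i%:R | i <- iota 0 (size (p - q)).+1]) pq_neq0.
rewrite size_map size_iota ltnNge leqnSn => /(_ _ _)/negP; apply => //.
  by apply/allP => _ /mapP[i _ ->]; rewrite /root !hornerE pq subrr.
by rewrite map_inj_uniq ?iota_uniq//; apply: mulrIn; apply: oner_neq0.
Qed.

Lemma stirling1_small j i : (j < i)%N -> stirling1 j i = 0.
Proof.
move=> ji; rewrite stirling1E big_pred0// => s; apply/negbTE.
by rewrite neq_ltn (leq_ltn_trans (leq_imset_card _ _)) ?card_ord.
Qed.

Lemma sum_stirling1_widen j n (F : nat -> int) : (j <= n)%N ->
  \sum_(i < j.+1) stirling1 j i * F i = \sum_(i < n.+1) stirling1 j i * F i.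
Proof.
move=> jn; rewrite -!(big_mkord predT (fun i => stirling1 j i * F i)).
rewrite [RHS](big_cat_nat _ (n := j.+1))//= [X in _ = _ + X]big_nat_cond.
by rewrite [X in _ = _ + X]big1 ?addr0// => i /andP[/andP[ji _] _]; rewrite stirling1_small ?mul0r.
Qed.

(** For [phi i = m ^ i] this is [sum_Clique_ffact] combined with
[sum_stirling1_exp]. Both sides are linear in [phi] and involve only its
values at [i <= n], so the case of all powers, which is an identity of
polynomials in [m], implies the general one by comparing coefficients. *)
Lemma sum_Clique_stirling1 n (A : {set edge n}) (phi : nat -> int) :
  \sum_(j < n.+1) \sum_(B in Clique n j | A \subset B)
     \sum_(i < j.+1) stirling1 j i * phi i = phi (ncomp A).
Proof.
pose c i := \sum_(j < n.+1) \sum_(B in Clique n j | A \subset B) stirling1 j i.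
have sum_c (F : nat -> int) : \sum_(j < n.+1) \sum_(B in Clique n j | A \subset B)
     \sum_(i < j.+1) stirling1 j i * F i = \sum_(i < n.+1) c i * F i.
  under [RHS]eq_bigr do rewrite /c mulr_suml.
  rewrite [RHS]exchange_big/=; apply: eq_bigr => j _.
  under [RHS]eq_bigr do rewrite mulr_suml.
  rewrite [RHS]exchange_big/=; apply: eq_bigr => B _.
  by apply: sum_stirling1_widen; rewrite -ltnS.
have lt_ncomp : (ncomp A < n.+1)%N.
  by rewrite ltnS ncompE (leq_trans (leq_imset_card _ _))// card_ord.
(* the identity for powers, read as an equality of polynomials in m *)
have polyc : \poly_(i < n.+1) c i = 'X^(ncomp A).
  apply: poly_eq_on_nat => m; rewrite horner_poly -sum_c hornerXn.
  rewrite -natrX -sum_Clique_ffact natr_sum; apply: eq_bigr => j _.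
  rewrite natr_sum; apply: eq_bigr => B _; exact: sum_stirling1_exp.
have cE i : (i < n.+1)%N -> c i = (i == ncomp A)%:R.
  by move=> lt_i; have /polyP/(_ i) := polyc; rewrite coef_poly lt_i coefXn.
rewrite sum_c (bigD1 (Ordinal lt_ncomp))//= cE// eqxx mul1r big1 ?addr0// => i.
by rewrite cE// -val_eqE/= => /negPf->; rewrite mul0r.
Qed.

Lemma sum_stirling1_above j k (phi : nat -> int) : (forall i, (i <= k)%N -> phi i = 0) ->
  \sum_(i < j.+1) stirling1 j i * phi i = \sum_(k.+1 <= i < j.+1) stirling1 j i * phi i.
Proof.
move=> phi0; rewrite big_geq_mkord [RHS]big_mkcond; apply: eq_bigr => i _ /=.
by case: ltnP => // /phi0->; rewrite mulr0.
Qed.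

Lemma tauE j k : tau j k = \sum_(i < j.+1) stirling1 j i * (k < i)%N%:R.
Proof.
rewrite (@sum_stirling1_above _ k (fun i => (k < i)%N%:R)) => [|i]; last first.
  by rewrite leqNgt => /negPf->.
by apply: eq_big_nat => i /andP[-> _]; rewrite mulr1.
Qed.

Lemma lambdaE j k : lambda j k = \sum_(i < j.+1) stirling1 j i * (i - k)%N%:Z.
Proof.
rewrite (@sum_stirling1_above _ k (fun i => (i - k)%N%:Z)) => [|i]; last first.
  by rewrite -subn_eq0 => /eqP->.
by apply: eq_big_nat => i /andP[/ltnW ki _]; rewrite subzn// mulrC.
Qed.

(** The clique edge sets with at most [k] parts do not contribute, which is why
the sums over [j] start at [k + 1]. *)
Lemma sum_stirling1_below j k (phi : nat -> int) : (forall i, (i <= k)%N -> phi i = 0) ->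
  (j <= k)%N -> \sum_(i < j.+1) stirling1 j i * phi i = 0.
Proof. by move=> phi0 jk; rewrite (sum_stirling1_above _ phi0) big_geq. Qed.

(** * Greedy spanning forests *)

Section Forests.
Variable n : nat.
Implicit Types (A B D F S : {set edge n}) (e : edge n) (x y : 'I_n).

Lemma adjU1 A e x y :
  adj (e |: A)%SET x y = (val e == [set x; y]%SET) || adj A x y.
Proof.
apply/adjP/orP => [[e' [/setU1P[->|e'A] ee]]|[/eqP ee|/adjP[e' [e'A ee]]]].
- by left; rewrite ee.
- by right; apply/adjP; exists e'.
- by exists e; rewrite setU11.
- by exists e'; rewrite setU1r.
Qed.

Lemma ncompU1_connect A e x y : val e = [set x; y]%SET -> connect (adj A) x y ->
  ncomp (e |: A)%SET = ncomp A.
Proof.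
move=> ee xy; apply/eqP; rewrite eqn_leq; apply/andP; split; first exact/leq_ncomp/finset.subsetUr.
rewrite [X in (_ <= X)%N]ncompE; apply: ncomp_leq_kernel => u v.
move/(fingraph.rootP (connect_adj_sym _)); apply: connect_sub => {}u {}v.
rewrite adjU1 => /orP[|uv]; last exact: connect1.
have yx : connect (adj A) y x by rewrite connect_adj_sym.
rewrite ee => /eqP exy.
have : u \in [set x; y]%SET by rewrite exy set21.
have : v \in [set x; y]%SET by rewrite exy set22.
by rewrite !inE => /orP[]/eqP-> /orP[]/eqP->; rewrite ?connect0.
Qed.

(** The components of [e |: A] are the fibres of the map [p] that sends a vertex
to the root of its component in [A], except that the component of [y] is sent
to the root of [x]. The image of [p] is the set of roots without that of [y]. *)
Lemma ncompU1_disconnect A e x y : val e = [set x; y]%SET -> ~~ connect (adj A) x y ->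
  ncomp A = (ncomp (e |: A)%SET).+1.
Proof.
move=> ee; rewrite -(root_connect (connect_adj_sym A)) => xy.
pose r := fingraph.root (adj A).
pose p v := if r v == r y then r x else r v.
have conn_p u : connect (adj (e |: A)%SET) u (p u).
  have toroot v : connect (adj (e |: A)%SET) v (r v).
    by apply: sub_connect_adj (connect_root _ _); apply: finset.subsetUr.
  rewrite /p; case: eqP => [uy|_]; last exact: toroot.
  apply: connect_trans (toroot u) _; rewrite uy.
  apply: (@connect_trans _ _ y); first by rewrite connect_adj_sym.
  apply: connect_trans _ (toroot x); apply: connect1.
  by rewrite adj_sym adjU1 ee eqxx.
have Ap : (e |: A)%SET \subset level_edges p.
  rewrite finset.subUset finset.sub1set (mem_level_edges _ ee) {1}/p (negPf xy) /p eqxx eqxx.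
  rewrite sub_level_edges; apply/forallP => u; apply/forallP => v.
  by apply/implyP => /eqP uv; rewrite /p /r uv.
have -> : ncomp (e |: A)%SET = #|p @: 'I_n|.
  apply: ncomp_kernel => u v; apply/idP/eqP => [/(sub_connect_adj Ap)|uv].
    by rewrite connect_level_edges => /eqP.
  apply: connect_trans (conn_p u) _; rewrite uv connect_adj_sym; exact: conn_p.
rewrite ncompE (cardsD1 (r y)) imset_f//= add1n; congr (#|pred_of_set _|.+1).
apply/setP => z; rewrite !inE; apply/andP/imsetP => [[zy /imsetP[v _ zv]]|[v _ ->]].
  by exists v => //; rewrite /p /r -zv (negPf zy).
rewrite /p; case: ifPn => [_|vy]; last by rewrite vy imset_f.
by rewrite xy imset_f.
Qed.

Lemma ncomp_leqU1 A e : (ncomp A <= (ncomp (e |: A)%SET).+1)%N.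
Proof.
have [x [y [_ ee]]] := edgeP e.
have [xy|/(ncompU1_disconnect ee)->//] := boolP (connect (adj A) x y).
by rewrite (ncompU1_connect ee xy).
Qed.

Lemma ncomp_leqU A D : (ncomp A <= ncomp (D :|: A)%SET + #|D|)%N.
Proof.
move cardD: #|D| => m; elim: m D cardD => [|m IH] D cardD.
  by move/cards0_eq: cardD => ->; rewrite finset.set0U addn0.
have [e eD] : exists e, e \in D by apply/card_gt0P; rewrite cardD.
have -> : (D :|: A = e |: ((D :\ e) :|: A))%SET by rewrite finset.setUA finset.setD1K.
have step a b c : (a <= b + m -> b <= c.+1 -> a <= c + m.+1)%N by lia.
apply: (step _ (ncomp ((D :\ e) :|: A)%SET)); last exact: ncomp_leqU1.
by apply: IH; move: cardD; rewrite (cardsD1 e D) eD => -[].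
Qed.

(** The lower bound of the greedy argument: at a time when the edges in [A] have
appeared, a forest [F] still misses at least [ncomp A - ncomp F] edges. *)
Lemma ncomp_leqD A F : (ncomp A <= ncomp F + #|F :\: A|%SET)%N.
Proof.
apply: leq_trans (ncomp_leqU A (F :\: A)%SET) _; rewrite leq_add2r leq_ncomp//.
by apply/fintype.subsetP => e eF; rewrite !inE eF andbT; case: (e \in A).
Qed.

Lemma ncomp_set0 : ncomp (finset.set0 : {set edge n}) = n.
Proof.
rewrite (@ncomp_kernel _ _ _ id) ?card_imset ?card_ord// => x y.
apply/idP/eqP => [/connectP[[|z s]]//=|->]; last exact: connect0.
by case/andP => /adjP[e []]; rewrite inE.
Qed.

Lemma ncomp_setT : (ncomp [set: edge n]%SET <= 1)%N.
Proof.
apply: (@leq_trans #|(fun=> tt) @: 'I_n|); last first.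
  by rewrite -card_unit max_card.
apply: ncomp_leq_kernel => x y _; have [->|xy] := eqVneq x y; first exact: connect0.
by apply: connect1; apply/adjP; exists (edge_of xy); rewrite inE.
Qed.

Lemma acyclic_set0 : acyclic (finset.set0 : {set edge n}).
Proof.
move=> [|x [|y s]]//= _ /andP[/= /andP[/adjP[e []]]].
by rewrite inE.
Qed.

(** A cycle through the new edge could be rotated to start with it; the rest of
the cycle would then be a path in [A] between the ends of [e]. *)
Lemma acyclicU1 A e x y : val e = [set x; y]%SET -> ~~ connect (adj A) x y ->
  acyclic A -> acyclic (e |: A)%SET.
Proof.
move=> ee xy acA c c_gt2 /andP[c_cycle c_uniq]; apply: (acA c) => //.
rewrite /ucycle c_uniq andbT; apply: cycle_from_next => // u uc.
have := next_cycle c_cycle uc; rewrite adjU1 => /orP[/eqP eu|//].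
exfalso; have [i s cs] := rot_to uc.
have : path.cycle (adj (e |: A)%SET) (u :: s) by rewrite -cs rot_cycle.
have : uniq (u :: s) by rewrite -cs rot_uniq.
have : (2 < size (u :: s))%N by rewrite -cs size_rot.
have : val e = [set u; next (u :: s) u]%SET by rewrite -cs next_rot.
case: s {cs} => [|v [|w s]]//; rewrite [next _ _]/= eqxx => euv _ us_uniq.
move=> /= /and3P[_ vw ws].
have off a b : a \notin val e -> adj (e |: A)%SET a b -> adj A a b.
  by rewrite adjU1 => /negP ae /orP[/eqP eab|//]; case: ae; rewrite eab set21.
(* the ends u and v of e are visited only once, so the other steps avoid e *)
have off_s a : a \in w :: s -> a \notin val e.
  move=> a_ws; rewrite euv !inE negb_or; apply/andP.
  have [u_off v_off _] := and3P us_uniq.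
  split; apply/eqP => av; last by move: v_off; rewrite -av a_ws.
  by move: u_off; rewrite -av in_cons a_ws orbT.
have vu : connect (adj A) v u.
  apply: (@connect_trans _ _ w).
    by apply: connect1; rewrite adj_sym off ?off_s ?mem_head// adj_sym.
  elim: s w {us_uniq vw} ws off_s => [|z s IH] w /=.
    by rewrite andbT => wu off_w; apply/connect1/off => //; rewrite off_w ?mem_head.
  move=> /andP[wz zs] off_s; apply: (@connect_trans _ _ z).
    by apply/connect1/off; rewrite ?off_s ?mem_head.
  by apply: IH => // a a_zs; apply: off_s; rewrite in_cons a_zs orbT.
have : x \in val e by rewrite ee set21.
have : y \in val e by rewrite ee set22.
have uv : connect (adj A) u v by rewrite connect_adj_sym.
by rewrite euv !inE => /orP[]/eqP yE /orP[]/eqP xE; move: xy; rewrite xE yE ?connect0 ?uv ?vu.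
Qed.

Section Greedy.
Variables (disp : Order.disp_t) (T : orderType disp) (t : edge n -> T) (k : nat).

(** The restriction of [F] to [S] has as few components as [S] and [k] permit. The
cardinality clause records what acyclicity says about [F :&: S]; it turns counts of
components into counts of edges. *)
Let spans F S :=
  ncomp (F :&: S)%SET = maxn (ncomp S) k /\ (#|F :&: S|%SET + ncomp (F :&: S)%SET = n)%N.

(** Induction on [A], removing an edge [e] of maximal time. Every sublevel set of
[A] is one of [A :\ e] or [A] itself, so only [A] has to be considered
when [e] is put back. The edge [e] enters the forest exactly if it lowers
[maxn (ncomp A) k], and then it joins two components of the forest. *)
Lemma greedy_forest_in A : (k <= n)%N ->
  exists F, [/\ F \subset A, acyclic F, spans F A
                & forall c, spans F [set e in A | (t e <= c)%O]%SET].
Proof.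
move=> kn; move cardA: #|A| => m.
have step a a' f f' c : a' = a.+1 -> f' = f.+1 -> maxn a k != maxn a' k ->
    f' = maxn a' k /\ (c + f' = n)%N -> f = maxn a k /\ (c.+1 + f = n)%N by lia.
elim: m A cardA => [|m IH] A cardA.
  have A0 : A = finset.set0 by apply/eqP; rewrite -cards_eq0 cardA.
  have span0 S : S = finset.set0 -> spans finset.set0 S.
    by move=> ->; rewrite /spans finset.setI0 ncomp_set0 cards0 (maxn_idPl kn).
  exists finset.set0; rewrite A0; split=> [|||c]; first exact: finset.sub0set.
  - exact: acyclic_set0.
  - exact: span0.
  - by apply: span0; apply/setP => e; rewrite !inE.
have [e0 e0A] : exists e, e \in A by apply/card_gt0P; rewrite cardA.
have [e eA e_max] : exists2 e, e \in A & forall a, a \in A -> (t a <= t e)%O.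
  by have [e eA e_max] := Order.TotalTheory.arg_maxP t e0A; exists e.
have [A' AE eA'] : exists2 A', A = (e |: A')%SET & e \notin A'.
  by exists (A :\ e)%SET; rewrite ?finset.setD1K// !inE eqxx.
have [|F [FA acF spF spFc]] := IH A'.
  by move: cardA; rewrite AE cardsU1 eA' => -[].
have FI : (F :&: A' = F)%SET by apply/finset.setIidPl.
have eF : e \notin F by apply: contra eA' => /(fintype.subsetP FA).
have FAA : F \subset A by by rewrite AE; apply: fintype.subset_trans FA _; apply: finset.subsetUr.
have low c : (c < t e)%O ->
    [set a in A | (t a <= c)%O]%SET = [set a in A' | (t a <= c)%O]%SET.
  move=> ce; apply/setP => a; rewrite AE !inE.
  by have [->|//] := eqVneq a e; rewrite (lt_geF ce) !andbF.
have high c : (t e <= c)%O -> [set a in A | (t a <= c)%O]%SET = A.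
  move=> ec; apply/setP => a; rewrite !inE; case aA: (a \in A) => //=.
  exact: le_trans (e_max _ aA) ec.
have [x [y [_ ee]]] := edgeP e.
have [same|diff] := eqVneq (maxn (ncomp A) k) (maxn (ncomp A') k).
  have spA : spans F A.
    move: spF; rewrite /spans FI (finset.setIidPl FAA) => -[nF cardF].
    by split; [rewrite nF; symmetry; exact same|exact cardF].
  exists F; split; [exact FAA|exact acF|exact spA|move=> c].
  have [ec|ce] := leP (t e) c; first by rewrite (high _ ec); exact spA.
  by rewrite (low _ ce); exact (spFc c).
have [xy|xy] := boolP (connect (adj A') x y).
  by move: diff; rewrite AE (ncompU1_connect ee xy) eqxx.
have nA' : ncomp A' = (ncomp A).+1 by rewrite AE -(ncompU1_disconnect ee xy).
have xyF : ~~ connect (adj F) x y.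
  by apply: contra xy; apply: sub_connect_adj.
have nF := ncompU1_disconnect ee xyF.
have eFA : (e |: F)%SET \subset A by rewrite finset.subUset finset.sub1set eA.
have spA : spans (e |: F)%SET A.
  rewrite /spans (finset.setIidPl eFA) cardsU1 eF.
  by apply: (step _ _ _ _ _ nA' nF diff); move: spF; rewrite /spans FI.
exists (e |: F)%SET; split; [exact eFA|exact: acyclicU1 ee xyF acF|exact spA|move=> c].
have [ec|ce] := leP (t e) c; first by rewrite (high _ ec); exact spA.
rewrite (low _ ce) /spans.
suff -> : ((e |: F) :&: [set a in A' | (t a <= c)%O] = F :&: [set a in A' | (t a <= c)%O])%SET.
  exact: spFc.
by apply/setP => a; rewrite !inE; case: eqVneq => //= ->; rewrite (negPf eA') andbF.
Qed.

(** Kruskal's algorithm stopped at [k] components. One forest is optimal at every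
level [c] at once, which makes it optimal after integration over [c]. *)
Lemma greedy_forest : (0 < k <= n)%N ->
  exists2 F, spanning_forest k F
    & forall c, #|F :\: [set e | (t e <= c)%O]|%SET
                  = (ncomp [set e | (t e <= c)%O]%SET - k)%N.
Proof.
have step f fs fd a b : (fs + fd = f -> f + k = n -> b = maxn a k ->
    fs + b = n -> fd = a - k)%N by lia.
move=> /andP[k_gt0 kn]; have [F [_ acF [nF cardF] spF]] := greedy_forest_in [set: edge n]%SET kn.
rewrite finset.setIT in nF cardF.
have {}nF : ncomp F = k.
  by rewrite nF; apply/maxn_idPr/(leq_trans ncomp_setT).
rewrite nF in cardF.
exists F => // c; have [] := spF c.
have -> : [set e in [set: edge n] | (t e <= c)%O]%SET = [set e | (t e <= c)%O]%SET.
  by apply/setP => e; rewrite !inE.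
move: [set e | (t e <= c)%O]%SET => S nS cardS.
exact (step _ _ _ _ _ (cardsID S F) cardF nS cardS).
Qed.

End Greedy.
End Forests.

Local Open Scope classical_set_scope.
Local Open Scope ereal_scope.

(** * Exponential times and their minima *)

(** The countable case [ae_foralln], applied to the ranks of the indices. *)
Lemma ae_forall_fin d (Omega : measurableType d) (R : realType)
    (P : {measure set Omega -> \bar R}) (I : finType) (Q : I -> Omega -> Prop) :
  (forall i, {ae P, forall w, Q i w}) -> {ae P, forall w, forall i, Q i w}.
Proof.
move=> aeQ.
have /ae_foralln : forall m : nat, {ae P, forall w, forall i, enum_rank i = m :> nat -> Q i w}.
  move=> m; have [lt_m|le_m] := ltnP m #|I|.
    apply: filterS (aeQ (enum_val (Ordinal lt_m))) => w Qw i im.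
    by rewrite -[i]enum_rankK (_ : enum_rank i = Ordinal lt_m)//; apply: val_inj.
  by apply: nearW => w i im; move: (ltn_ord (enum_rank i)); rewrite im ltnNge le_m.
by apply: filterS => w Qw i; apply: Qw (erefl _).
Qed.

Section ExponentialTime.
Context d (Omega : measurableType d) (R : realType) (P : probability Omega R).
Variables (r : R) (X : Omega -> \bar R).
Hypothesis X_exp : exponential_time P r X.

Let mX : measurable_fun [set: Omega] X. Proof. by case: X_exp. Qed.

Let tailX (s : R) : (0 <= s)%R -> P [set w | s%:E < X w] = (expR (- (r * s)))%:E.
Proof. by case: X_exp => _; apply. Qed.

Lemma measurable_tail (x : \bar R) : measurable [set w | x < X w].
Proof. by rewrite -[X in measurable X]setTI; exact: emeasurable_fun_o_infty. Qed.

Lemma measurable_infinite : measurable [set w | X w = +oo].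
Proof.
have -> : [set w | X w = +oo] = [set w | +oo <= X w].
  by apply/seteqP; split => w /=; rewrite leye_eq => /eqP.
by rewrite -[X in measurable X]setTI; exact: emeasurable_fun_c_infty.
Qed.

Lemma ae_of_probability1 (A : set Omega) : measurable A -> P A = 1 -> {ae P, forall w, A w}.
Proof.
move=> mA PA; exists (~` A); split => //; first exact: measurableC.
by rewrite probability_setC// PA subee.
Qed.

Lemma exponential_time_gt0 : {ae P, forall w, 0 < X w}.
Proof.
apply: ae_of_probability1 (measurable_tail 0) _.
by rewrite (tailX (lexx 0)) mulr0 oppr0 expR0.
Qed.

Lemma exponential_time_rate0 : r = 0%R -> {ae P, forall w, X w = +oo}.
Proof.
move=> r0.
have /ae_foralln : forall m : nat, {ae P, forall w, m%:R%:E < X w}.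
  move=> m; apply: ae_of_probability1 (measurable_tail _) _.
  by rewrite tailX// r0 mul0r oppr0 expR0.
apply: filterS => w Xw; apply/eqyP => A A_gt0.
have [m Am] : exists m : nat, (A < m%:R)%R.
  by exists (Num.truncn A).+1; rewrite truncnS_gt.
by apply: ltW; apply: lt_trans (Xw m); rewrite lte_fin.
Qed.

Hypothesis r_gt0 : (0 < r)%R.

(** The bound [P (X = +oo) <= expR (- (r * s))] holds for every [s >= 0]. *)
Lemma exponential_time_infinite : P [set w | X w = +oo] = 0.
Proof.
have finI : P [set w | X w = +oo] \is a fin_num.
  by apply: fin_num_measure; exact: measurable_infinite.
have I_le s : (0 <= s)%R -> P [set w | X w = +oo] <= (expR (- (r * s)))%:E.
  move=> s_ge0; rewrite -tailX//; apply: le_measure; rewrite ?inE//.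
  - exact: measurable_infinite.
  - exact: measurable_tail.
  - by move=> w /= ->; rewrite ltry.
apply/eqP; rewrite eq_le measure_ge0 andbT leNgt; apply/negP.
rewrite -(fineK finI) lte_fin => p_gt0; set p := fine _ in p_gt0.
have : P [set w | X w = +oo] <= (expR (- p^-1))%:E.
  (* this s gives expR (- p^-1), which is below p because expR p^-1 > p^-1 *)
  have := I_le (r^-1 * p^-1)%R; rewrite mulrA divff ?gt_eqF// mul1r; apply.
  by rewrite mulr_ge0// invr_ge0 ltW.
rewrite -(fineK finI) lee_fin -/p expRN leNgt => /negP; apply.
rewrite invf_plt ?posrE ?expR_gt0//.
by apply: lt_le_trans (expR_ge1Dx _); rewrite ltrDr.
Qed.

Lemma exponential_time_fin : {ae P, forall w, X w < +oo}.
Proof.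
exists [set w | X w = +oo]; split; last 1 first.
- by move=> w /=; rewrite ltey => /negP/negPn/eqP.
- exact: measurable_infinite.
- exact: exponential_time_infinite.
Qed.

Lemma integral_expR_tail :
  \int[lebesgue_measure]_(s in `[0%R, +oo[) (expR (- (r * s)))%:E = (r^-1)%:E.
Proof.
have mf : measurable_fun [set: R] (fun s : R => (r * expR (- (r * s)))%:E).
  apply/measurable_EFinP/measurable_funM => //; apply: measurableT_comp => //.
  by apply: measurableT_comp => //; apply: measurable_funM.
transitivity (\int[lebesgue_measure]_(s in `[0%R, +oo[)
    ((r^-1)%:E * (r * expR (- (r * s)))%:E)).
  by apply: eq_integral => s _; rewrite -EFinM mulKf// gt_eqF.
rewrite ge0_integralZl//; first last.
- by rewrite lee_fin invr_ge0 ltW.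
- by move=> s _; rewrite lee_fin mulr_ge0 ?expR_ge0// ltW.
- exact: measurable_funTS.
rewrite -[RHS]mule1 -(integral_exponential_pdf r_gt0) [in LHS]integral_mkcond.
congr (_ * _); apply: eq_integral => s _; rewrite /exponential_pdf !patchE.
by case: ifP; rewrite ?mulNr.
Qed.

(** The mean is the integral of the tail. That formula needs a nonnegative
real-valued variable, so [X] is first replaced by the finite part of its
positive part, which is almost surely equal to it. *)
Lemma integral_exponential_time : \int[P]_w X w = (r^-1)%:E.
Proof.
pose y w := fine (maxe 0 (X w)).
have my : measurable_fun [set: Omega] y.
  apply: (measurableT_comp (fine_measurable measurableT)) => //.
  exact: measurable_maxe.
have y_ge0 w : (0 <= y w)%R by apply: fine_ge0; rewrite le_max lexx.
pose Y : {RV P >-> R} := mfun_Sub (mem_set my : y \in mfun).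
have -> : \int[P]_w X w = \int[P]_w (y w)%:E.
  apply: ae_eq_integral => //; first exact/measurable_EFinP.
  near=> w => _; rewrite /y max_r; last by apply: ltW; near: w; exact: exponential_time_gt0.
  rewrite fineK// fin_numElt; apply/andP; split; last by near: w; exact: exponential_time_fin.
  by apply: (@lt_trans _ _ 0) => //; near: w; exact: exponential_time_gt0.
have := @ge0_expectation_ccdf _ _ _ P Y y_ge0; rewrite expectation_def /= => ->.
rewrite -integral_expR_tail; apply: eq_integral => s.
rewrite inE/= in_itv/= andbT => s_ge0; rewrite -tailX// /ccdf /distribution /pushforward /=.
have tailE : [set w | s%:E < X w] = (y @^-1` `]s, +oo[) `|` [set w | X w = +oo].
  apply/seteqP; split => w /=; rewrite in_itv/= andbT /y.
    case: (X w) => [x| |]//=; last by right.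
    by rewrite -EFin_max/= lte_fin lt_max => ->; left; rewrite orbT.
  case=> [|->]; last exact: ltry.
  case: (X w) => [x| |].
  - by rewrite -EFin_max/= lte_fin lt_max ltNge s_ge0.
  - by rewrite ltry.
  - by rewrite max_l ?leNye//= ltNge s_ge0.
rewrite tailE measureU0//.
- by rewrite -[X in measurable X]setTI; apply: (my measurableT); exact: measurable_itv.
- exact: measurable_infinite.
- exact: exponential_time_infinite.
Unshelve. all: by end_near. Qed.

Lemma integrable_exponential_time : P.-integrable [set: Omega] X.
Proof.
apply/integrableP; split => //.
rewrite (ae_eq_integral X)//; last 2 first.
- exact: measurableT_comp.
- apply: filterS exponential_time_gt0 => w Xw _.
  by rewrite gee0_abs// ltW.
by rewrite integral_exponential_time ltry.
Qed.

End ExponentialTime.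

Lemma measurable_big d (Omega : measurableType d) (R : realType)
    (op : \bar R -> \bar R -> \bar R) (idx : \bar R)
    (I : Type) (s : seq I) (Q : pred I) (f : I -> Omega -> \bar R) :
  (forall g h : Omega -> \bar R, measurable_fun [set: Omega] g ->
    measurable_fun [set: Omega] h -> measurable_fun [set: Omega] (fun w => op (g w) (h w))) ->
  (forall i, Q i -> measurable_fun [set: Omega] (f i)) ->
  measurable_fun [set: Omega] (fun w => \big[op/idx]_(i <- s | Q i) f i w).
Proof.
move=> mop mf; elim: s => [|i s IH].
  by (under eq_fun do rewrite big_nil); exact: measurable_cst.
case Qi: (Q i).
  by (under eq_fun do rewrite big_cons Qi); apply: mop => //; exact: mf.
by (under eq_fun do rewrite big_cons Qi).
Qed.

Definition first_time (R : realType) (Omega : Type) (I : finType) (t : I -> Omega -> \bar R)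
  (J : {set I}) (w : Omega) : \bar R := \big[mine/+oo]_(i in J) t i w.

Lemma first_time_gtP (R : realType) (Omega : Type) (I : finType) (t : I -> Omega -> \bar R)
    (J : {set I}) (w : Omega) (s : R) :
  reflect (forall i, i \in J -> s%:E < t i w) (s%:E < first_time t J w).
Proof.
apply: (iffP idP) => [lt_s i iJ|lt_s].
  by apply: lt_le_trans lt_s _; rewrite /first_time; exact: bigmin_le_cond.
by rewrite /first_time; apply: lt_bigmin => //; exact: ltry.
Qed.

(** The tail of a minimum is the intersection of the tails; by independence its
probability is the product of exponentials, and the rates add up. *)
Lemma first_time_exponential d (Omega : measurableType d) (R : realType)
    (P : probability Omega R) (I : finType) (a : I -> R) (t : I -> Omega -> \bar R)
    (J : {set I}) :
  (forall i, exponential_time P (a i) (t i)) -> mutually_independent P t ->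
  exponential_time P (\sum_(i in J) a i) (first_time t J).
Proof.
move=> t_exp t_indep; split=> [|s s_ge0].
  apply: measurable_big => [g h|i _]; first exact: measurable_mine.
  by have [] := t_exp i.
have mtail : measurable [set x : \bar R | s%:E < x].
  by rewrite -[X in measurable X]setTI; apply: emeasurable_fun_o_infty => //.
have -> : [set w | s%:E < first_time t J w]
    = \bigcap_(i in [set` J]) (t i @^-1` [set x | s%:E < x]).
  by apply/seteqP; split => w /first_time_gtP.
rewrite (t_indep J (fun=> [set x | s%:E < x]))//.
transitivity (\prod_(i in J) (expR (- (a i * s)))%:E).
  by apply: eq_bigr => i _; have [_ <-//] := t_exp i.
rewrite prodEFin; congr EFin.
rewrite mulr_suml -sumrN.
by apply: (big_ind2 (fun x y => x = expR y)) => // [|x1 x2 y1 y2 -> ->]; rewrite ?expR0 ?expRD.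
Qed.

(** * Lifetimes as Lebesgue measures *)

Section Alive.
Variable R : realType.
Implicit Type x : \bar R.

(** The moments before an event that occurs at time [x]. The Lebesgue measure of
this set is [x], so integrals over time of such indicators are times. *)
Definition alive x : set R := [set s | (0 <= s)%R /\ s%:E < x].

Lemma alive_fin (x : R) : alive x%:E = `[0%R, x[.
Proof. by apply/seteqP; split => s; rewrite /alive /= in_itv/= ?lte_fin => /andP. Qed.

Lemma alive_pinfty : alive +oo = `[0%R, +oo[.
Proof.
by apply/seteqP; split => s; rewrite /alive /= in_itv/= andbT; [case|move=> ?; rewrite ltry].
Qed.

Lemma alive_ninfty : alive -oo = set0.
Proof. by rewrite -subset0 => s [_]. Qed.

Lemma measurable_alive x : measurable (alive x).
Proof. by case: x => [x| |]; rewrite ?alive_fin ?alive_pinfty ?alive_ninfty. Qed.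

Lemma lebesgue_alive x : 0 <= x -> lebesgue_measure (alive x) = x.
Proof.
case: x => [x| |]; last by rewrite leeNy_eq.
  rewrite lee_fin alive_fin lebesgue_measure_itv/= lte_fin.
  by case: ltgtP => // [_ _|<- _//]; rewrite oppr0 adde0.
by move=> _; rewrite alive_pinfty lebesgue_measure_itv/= ltry oppr0 addye.
Qed.

Lemma integral_alive x : 0 <= x ->
  \int[lebesgue_measure]_(s in `[0%R, +oo[) (\1_(alive x) s)%:E = x.
Proof.
move=> x_ge0; rewrite integral_indic//; last exact: measurable_alive.
rewrite setIidl; first exact: lebesgue_alive.
by move=> s [s_ge0 _]; rewrite /= in_itv/= s_ge0.
Qed.

Lemma measurable_indic_alive x (D : set R) : measurable_fun D (fun s => (\1_(alive x) s : R)%:E).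
Proof.
apply: measurable_funTS; apply/measurable_EFinP/measurable_indic.
exact: measurable_alive.
Qed.

Lemma indic_alive x s : (0 <= s)%R -> \1_(alive x) s = ((s%:E < x)%E%:R)%R :> R.
Proof.
move=> s_ge0; rewrite indicE; congr (nat_of_bool _)%:R.
by apply/idP/idP; rewrite inE /alive/=; [case|].
Qed.

End Alive.

Section Flats.
Variable n : nat.

(** The closed sets of the graphic matroid that have more than [k] components.
The number of parts of a clique edge set is recovered as its number of
components, so the double sums over [j] and [B] become sums over [B] alone. *)
Definition flat (k : nat) : pred {set edge n} :=
  fun B => (B \in Clique n (ncomp B)) && (k < ncomp B)%N.

Lemma sum_flats (V : nmodType) k (F : nat -> {set edge n} -> V) :
  (\sum_(k.+1 <= j < n.+1) \sum_(B in Clique n j) F j B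
    = \sum_(B | flat k B) F (ncomp B) B)%R.
Proof.
have lt_ncomp (B : {set edge n}) : (ncomp B < n.+1)%N.
  by rewrite ltnS ncompE (leq_trans (leq_imset_card _ _))// card_ord.
rewrite big_geq_mkord.
rewrite [RHS](partition_big (fun B => Ordinal (lt_ncomp B)) (fun j => k < j)%N) /=; last first.
  by move=> B /andP[].
apply: eq_bigr => j kj; apply: eq_big => [B|B /ncomp_Clique<-//].
apply/idP/andP => [BC|[/andP[BC _] /eqP<-]]; last exact: BC.
have nB := ncomp_Clique BC; split; first by rewrite /flat nB BC kj.
by apply/eqP/val_inj; exact nB.
Qed.

(** Equal to [tau j k] for the indicator of [i > k], and to [lambda j k] for the
truncated difference [i - k]. *)
Definition stirling_coef (phi : nat -> int) (j : nat) : int :=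
  (\sum_(i < j.+1) stirling1 j i * phi i)%R.

Variables (R : realType) (Omega : Type) (t : edge n -> Omega -> \bar R) (w : Omega).

(** The graph stays inside [B] until the first edge outside [B] appears. *)
Lemma sub_G s (B : {set edge n}) :
  (G t s w \subset B) = (s%:E < first_time t (~: B)%SET w).
Proof.
apply/fintype.subsetP/first_time_gtP => GB e.
  by rewrite inE; apply: contraNT; rewrite -leNgt => es; apply: GB; rewrite inE.
rewrite inE => es; apply/negPn/negP => eB.
by have := GB e; rewrite inE eB ltNge es => /(_ isT).
Qed.

(** [sum_Clique_stirling1] for [A := G t s w], with each inclusion read as a
condition on [s]. *)
Lemma profile_flats k (phi : nat -> int) s : (forall i, (i <= k)%N -> phi i = 0%R) ->
    (0 <= s)%R ->
  ((phi (ncomp (G t s w)))%:~R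
    = \sum_(B | flat k B) (stirling_coef phi (ncomp B))%:~R
        * \1_(alive (first_time t (~: B)%SET w)) s :> R)%R.
Proof.
move=> phi0 s_ge0.
rewrite -(sum_flats _ (fun j B => (stirling_coef phi j)%:~R
        * \1_(alive (first_time t (~: B)%SET w)) s : R)%R).
rewrite -sum_Clique_stirling1 rmorph_sum big_geq_mkord/=.
rewrite [LHS](bigID (fun j : 'I_n.+1 => (k < j)%N))/= [X in (_ + X)%R]big1 ?addr0; last first.
  move=> j; rewrite -leqNgt => jk; rewrite big1// => B _.
  exact: sum_stirling1_below jk.
apply: eq_bigr => j _; rewrite big_mkcondr rmorph_sum/=; apply: eq_bigr => B _.
rewrite indic_alive// -sub_G; case: ifP => _; last by rewrite mulr0.
by rewrite mulr1.
Qed.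

End Flats.

(** * Pathwise formulas for the hitting time and the forest length *)

Lemma integral_sum_in d (X : measurableType d) (R : realType)
    (mu : {measure set X -> \bar R}) (D : set X) (I : finType) (Q : pred I)
    (f : I -> X -> \bar R) : measurable D ->
  (forall i, Q i -> mu.-integrable D (f i)) ->
  \int[mu]_(x in D) \sum_(i | Q i) f i x = \sum_(i | Q i) \int[mu]_(x in D) f i x.
Proof.
move=> mD intf; rewrite [RHS]big_mkcond.
transitivity (\int[mu]_(x in D) \sum_i (if Q i then f i x else 0)).
  by apply: eq_integral => x _; rewrite big_mkcond.
rewrite integral_sum//; last first.
  by move=> i; have [/intf//|_] := boolP (Q i); exact: integrable0.
by apply: eq_bigr => i _; case: (Q i) => //; rewrite integral0.
Qed.

Section Pathwise.
Variables (R : realType) (n : nat) (Omega : Type) (t : edge n -> Omega -> \bar R).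
Variables (k : nat) (w : Omega).

(** [G] has at most [k] components as soon as it contains some edge set [A] with
at most [k] components. This writes [T] with finitely many minima and maxima:
it is measurable, and the infimum that defines it is attained. *)
Lemma T_bigmin : T t k w
  = \big[mine/+oo]_(A : {set edge n} | (ncomp A <= k)%N) \big[maxe/0]_(e in A) t e w.
Proof.
apply/eqP; rewrite eq_le; apply/andP; split.
  apply: le_bigmin => [|A Ak]; first exact: leey.
  have : 0 <= \big[maxe/0]_(e in A) t e w by exact: bigmax_ge_id.
  have /bigmax_leP[_] := lexx (\big[maxe/0]_(e in A) t e w).
  case: (\big[maxe/0]_(e in A) t e w) => [s| |] // tA s_ge0; last exact: leey.
  apply: ereal_inf_lbound; exists s => //=; split; first by rewrite -lee_fin.
  apply: leq_trans Ak; apply: leq_ncomp; apply/fintype.subsetP => e eA.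
  by rewrite inE tA.
apply: le_ereal_inf_tmp => _ [s [s_ge0 Gk] <-].
apply: le_trans (bigmin_le_cond _ _ Gk) _.
by apply/bigmax_leP; split=> [|e]; [rewrite lee_fin|rewrite inE].
Qed.

Lemma T_leE s : (0 <= s)%R -> (T t k w <= s%:E) = (ncomp (G t s w) <= k)%N.
Proof.
move=> s_ge0; apply/idP/idP => [|Gk]; last by apply: ereal_inf_lbound; exists s.
rewrite T_bigmin => /bigmin_leP[|[A Ak /bigmax_leP[_ tA]]]; first by rewrite leye_eq.
apply: leq_trans Ak; apply: leq_ncomp; apply/fintype.subsetP => e eA.
by rewrite inE tA.
Qed.

Lemma T_ge0 : 0 <= T t k w.
Proof. by apply: le_ereal_inf_tmp => _ [s [s_ge0 _] <-]; rewrite lee_fin. Qed.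

(** By [T_leE], the indicator of [k < ncomp (G s)] is that of [s < T]. *)
Lemma T_integral : T t k w
  = \int[lebesgue_measure]_(s in `[0%R, +oo[) (((k < ncomp (G t s w))%N%:R : int)%:~R : R)%:E.
Proof.
rewrite -[LHS](integral_alive T_ge0); apply: eq_integral => s.
rewrite inE/= in_itv/= andbT => s_ge0; rewrite indic_alive// ltNge T_leE// -ltnNge.
by case: ltnP.
Qed.

Hypothesis t_ge0 : forall e, 0 <= t e w.

Lemma card_diff_G (F : {set edge n}) s : (0 <= s)%R ->
  (#|F :\: G t s w|%SET)%:R%:E = \sum_(e <- enum F) (\1_(alive (t e w)) s : R)%:E.
Proof.
move=> s_ge0; rewrite sumEFin; congr EFin; rewrite big_enum/=.
under eq_bigr do rewrite indic_alive//.
rewrite -natr_sum -big_mkcondr sum1_card; congr (_%:R); apply: eq_card => e.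
by rewrite finset.in_setD [X in ~~ X]inE -ltNge andbC.
Qed.

(** An edge contributes to the integrand exactly until it appears. *)
Lemma sum_times_integral (F : {set edge n}) : \sum_(e in F) t e w
  = \int[lebesgue_measure]_(s in `[0%R, +oo[) ((#|F :\: G t s w|%SET)%:R : R)%:E.
Proof.
transitivity (\int[lebesgue_measure]_(s in `[0%R, +oo[)
    \sum_(e <- enum F) (\1_(alive (t e w)) s : R)%:E); last first.
  by apply: eq_integral => s; rewrite inE/= in_itv/= andbT => s_ge0; rewrite card_diff_G.
rewrite ge0_integral_sum//; last by move=> e; exact: measurable_indic_alive.
by rewrite big_enum/=; apply: eq_bigr => e _; rewrite integral_alive.
Qed.

Lemma measurable_card_diff_G (F : {set edge n}) :
  measurable_fun (`[0%R, +oo[ : set R) (fun s : R => ((#|F :\: G t s w|%SET)%:R : R)%:E).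
Proof.
apply: (eq_measurable_fun (fun s => \sum_(e <- enum F) (\1_(alive (t e w)) s : R)%:E)).
  by move=> s; rewrite inE/= in_itv/= andbT => s_ge0; rewrite card_diff_G.
by apply: emeasurable_sum => e; exact: measurable_indic_alive.
Qed.

Lemma measurable_profile (phi : nat -> int) : (forall i, (i <= k)%N -> phi i = 0%R) ->
  measurable_fun (`[0%R, +oo[ : set R) (fun s : R => ((phi (ncomp (G t s w)))%:~R : R)%:E).
Proof.
move=> phi0; apply: (eq_measurable_fun (fun s => \sum_B (if flat k B then
    (stirling_coef phi (ncomp B))%:~R%:E * (\1_(alive (first_time t (~: B)%SET w)) s : R)%:E
    else 0))).
  move=> s; rewrite inE/= in_itv/= andbT => s_ge0; rewrite (@profile_flats _ R _ t w k phi s phi0 s_ge0).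
  by rewrite -sumEFin [RHS]big_mkcond.
apply: emeasurable_sum => B; case: (flat k B); last exact: measurable_cst.
by apply: emeasurable_funM; [exact: measurable_cst|exact: measurable_indic_alive].
Qed.

(** By [ncomp_leqD] every [k]-forest misses at least [ncomp (G s) - k] edges at
time [s], and the greedy forest misses exactly that many. *)
Lemma L_integral : (0 < k <= n)%N -> L t k w
  = \int[lebesgue_measure]_(s in `[0%R, +oo[) (((ncomp (G t s w) - k)%N%:Z)%:~R : R)%:E.
Proof.
move=> kn; apply/eqP; rewrite eq_le; apply/andP; split.
  have [F Fk FG] := greedy_forest (fun e => t e w) kn.
  have FP : `[< spanning_forest k F >] by exact/asboolP.
  apply: le_trans (bigmin_le_cond _ _ FP) _.
  rewrite sum_times_integral; apply: ge0_le_integral => //.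
  - exact: measurable_card_diff_G.
  - apply: (@measurable_profile (fun i => (i - k)%N%:Z)) => i.
    by rewrite -subn_eq0 => /eqP->.
  - by move=> s _; rewrite lee_fin (FG s%:E).
apply: le_bigmin => [|F /asboolP[_ Fk]]; first exact: leey.
rewrite sum_times_integral; apply: ge0_le_integral => //.
- apply: (@measurable_profile (fun i => (i - k)%N%:Z)) => i.
  by rewrite -subn_eq0 => /eqP->.
- exact: measurable_card_diff_G.
move=> s _; rewrite lee_fin -pmulrn ler_nat leq_subLR -[X in (X + _)%N]Fk.
exact: ncomp_leqD.
Qed.

(** Finiteness of the first times makes each indicator integrable, so that the
sum, whose coefficients have both signs, can be integrated term by term. *)
Lemma integral_profile (phi : nat -> int) : (forall i, (i <= k)%N -> phi i = 0%R) ->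
  (forall B : {set edge n}, flat k B -> first_time t (~: B)%SET w < +oo) ->
  \int[lebesgue_measure]_(s in `[0%R, +oo[) ((phi (ncomp (G t s w)))%:~R : R)%:E
  = \sum_(B | flat k B) (stirling_coef phi (ncomp B))%:~R%:E * first_time t (~: B)%SET w.
Proof.
move=> phi0 fin; have first_ge0 B : 0 <= first_time t (~: B)%SET w.
  by apply: le_bigmin => // ; exact: leey.
transitivity (\int[lebesgue_measure]_(s in `[0%R, +oo[) \sum_(B | flat k B)
    (stirling_coef phi (ncomp B))%:~R%:E * (\1_(alive (first_time t (~: B)%SET w)) s : R)%:E).
  apply: eq_integral => s; rewrite inE/= in_itv/= andbT => s_ge0.
  by rewrite (@profile_flats _ R _ t w k phi s phi0 s_ge0) -sumEFin.
have int_alive B : flat k B -> lebesgue_measure.-integrable (`[0%R, +oo[ : set R)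
    (fun s : R => (\1_(alive (first_time t (~: B)%SET w)) s : R)%:E).
  move=> kB; apply/integrableP; split; first exact: measurable_indic_alive.
  under eq_integral do rewrite gee0_abs ?lee_fin//.
  by rewrite integral_alive// fin.
rewrite integral_sum_in//; last by move=> B kB; apply: integrableZl => //; exact: int_alive.
apply: eq_bigr => B kB; rewrite integralZl//; last exact: int_alive.
by rewrite integral_alive.
Qed.

End Pathwise.

(** * Expectations *)

Section Expectation.
Context (R : realType) (d : measure_display) (Omega : measurableType d).
Variables (P : probability Omega R) (n k : nat).
Variables (a : edge n -> R) (t : edge n -> Omega -> \bar R).
Hypotheses (a_ge0 : forall e, (0 <= a e)%R)
  (t_exp : forall e, exponential_time P (a e) (t e))
  (t_indep : mutually_independent P t).

Let mt e : measurable_fun [set: Omega] (t e). Proof. by case: (t_exp e). Qed.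

Lemma measurable_T : measurable_fun [set: Omega] (T t k).
Proof.
have -> : T t k = fun w => \big[mine/+oo]_(A : {set edge n} | (ncomp A <= k)%N)
    \big[maxe/0]_(e in A) t e w by apply/funext => w; exact: T_bigmin.
apply: measurable_big => [g h|A _]; first exact: measurable_mine.
by apply: measurable_big => [g h|e _ //]; exact: measurable_maxe.
Qed.

Lemma measurable_L : measurable_fun [set: Omega] (L t k).
Proof.
apply: measurable_big => [g h|F _]; first exact: measurable_mine.
by apply: measurable_big => [g h|e _ //]; exact: emeasurable_funD.
Qed.

Lemma times_gt0 : {ae P, forall w, forall e, 0 < t e w}.
Proof. by apply: ae_forall_fin => e; exact: exponential_time_gt0 (t_exp e). Qed.

(** Common to [T] and [L]: almost surely all times are positive and all relevant
first times are finite, so [H] is the linear combination of first times in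
[integral_profile], and each first time has mean the inverse of its rate. *)
Lemma expectation_profile (phi : nat -> int) (H : Omega -> \bar R) :
  (forall i, (i <= k)%N -> phi i = 0%R) ->
  (forall B : {set edge n}, flat k B -> weight a (~: B)%SET != 0%R) ->
  measurable_fun [set: Omega] H ->
  (forall w, (forall e, 0 <= t e w) -> H w
     = \int[lebesgue_measure]_(s in `[0%R, +oo[) ((phi (ncomp (G t s w)))%:~R : R)%:E) ->
  \int[P]_w H w = (\sum_(k.+1 <= j < n.+1) \sum_(B in Clique n j)
            (stirling_coef phi j)%:~R / weight a (~: B)%SET)%R%:E.
Proof.
move=> phi0 w_neq0 mH HE.
have w_gt0 (B : {set edge n}) : flat k B -> (0 < weight a (~: B)%SET)%R.
  by move=> kB; rewrite lt_def w_neq0//= sumr_ge0.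
have first_exp J : exponential_time P (weight a J) (first_time t J).
  exact: first_time_exponential.
transitivity (\int[P]_w \sum_(B | flat k B)
    (stirling_coef phi (ncomp B))%:~R%:E * first_time t (~: B)%SET w).
  apply: ae_eq_integral => //.
    apply: measurable_big => [g h|B _]; first exact: emeasurable_funD.
    by apply: emeasurable_funM; [exact: measurable_cst|have [] := first_exp (~: B)%SET].
  have fin : {ae P, forall w, forall B : {set edge n}, flat k B -> first_time t (~: B)%SET w < +oo}.
    apply: ae_forall_fin => B; have [kB|nkB] := boolP (flat k B); last exact: nearW.
    by apply: filterS (exponential_time_fin (first_exp _) (w_gt0 _ kB)) => w.
  apply: filterS2 times_gt0 fin => w t_gt0 fin _.
  have t_ge0 e : 0 <= t e w by exact: ltW.
  by rewrite HE// (integral_profile t_ge0 phi0 fin).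
rewrite integral_sum_in//; last first.
  move=> B kB; apply: integrableZl => //.
  exact: integrable_exponential_time (first_exp _) (w_gt0 _ kB).
rewrite (sum_flats k (fun j B => (stirling_coef phi j)%:~R / weight a (~: B)%SET)%R) -sumEFin.
apply: eq_bigr => B kB; rewrite integralZl//; last first.
  exact: integrable_exponential_time (first_exp _) (w_gt0 _ kB).
by rewrite (integral_exponential_time (first_exp _) (w_gt0 _ kB)).
Qed.

(** The rates are nonnegative, so all edges outside [B] have rate zero. *)
Lemma times_infinite (B : {set edge n}) : weight a (~: B)%SET = 0%R ->
  {ae P, forall w, forall e, e \notin B -> t e w = +oo}.
Proof.
move=> wB; apply: ae_forall_fin => e; have [eB|eB] := boolP (e \in B); first exact: nearW.
have /psumr_eq0P a0 : (\sum_(e in ~: B) a e = 0)%R by [].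
by apply: filterS (exponential_time_rate0 (t_exp e) (a0 _ e _)) => //; rewrite inE.
Qed.

Lemma integral_infinite (H : Omega -> \bar R) : measurable_fun [set: Omega] H ->
  {ae P, forall w, H w = +oo} -> \int[P]_w H w = +oo.
Proof.
move=> mH Hoo; rewrite (ae_eq_integral (cst +oo))//.
  by rewrite integral_cst// [X in _ * X](_ : _ = 1) ?mule1//; exact: probability_setT.
by apply: filterS Hoo => w ->.
Qed.

Lemma T_infinite (B : {set edge n}) w : (k < ncomp B)%N ->
  (forall e, e \notin B -> t e w = +oo) -> T t k w = +oo.
Proof.
move=> kB too; rewrite T_bigmin; apply/eqP; rewrite eq_le leey /=.
apply: le_bigmin => // A Ak.
have [e eA eB] : exists2 e, e \in A & e \notin B.
  apply/fintype.subsetPn; apply/negP => AB.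
  by have := leq_trans kB (leq_trans (leq_ncomp AB) Ak); rewrite ltnn.
by rewrite -(too e eB); exact: le_bigmax_cond.
Qed.

Lemma L_infinite (B : {set edge n}) w : (k < ncomp B)%N -> (forall e, 0 < t e w) ->
  (forall e, e \notin B -> t e w = +oo) -> L t k w = +oo.
Proof.
move=> kB t_gt0 too; apply/eqP; rewrite eq_le leey /=.
apply: le_bigmin => // F /asboolP[_ Fk].
have [e eF eB] : exists2 e, e \in F & e \notin B.
  apply/fintype.subsetPn; apply/negP => FB.
  by have := leq_trans kB (leq_ncomp FB); rewrite Fk ltnn.
rewrite (bigD1 e)//= too// addye// gt_eqF// (lt_le_trans ltNy0)// sume_ge0// => i _.
exact: ltW.
Qed.

End Expectation.

Local Close Scope ereal_scope.
Local Close Scope classical_set_scope.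

Theorem theorem1p1 (R : realType) (d : measure_display)
    (Omega : measurableType d) (P : probability Omega R)
    (n k : nat) (a : edge n -> R) (t : edge n -> Omega -> \bar R)
    (k_gt0 : (0 < k)%N) (k_le_n : (k <= n)%N)
    (a_ge0 : forall e, 0 <= a e)
    (t_exp : forall e, exponential_time P (a e) (t e))
    (t_indep : mutually_independent P t) :
  ((forall (j : nat) (B : {set edge n}), (k < j)%N -> B \in Clique n j ->
       weight a (~: B) != 0) ->
     (\int[P]_w T t k w)%E
       = (\sum_(k.+1 <= j < n.+1) \sum_(B in Clique n j)
            (tau j k)%:~R / weight a (~: B))%:E
     /\
     (\int[P]_w L t k w)%E
       = (\sum_(k.+1 <= j < n.+1) \sum_(B in Clique n j)
            (lambda j k)%:~R / weight a (~: B))%:E)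
  /\
  (* Rates for which a denominator vanishes: both expectations are infinite. *)
  ((exists (j : nat) (B : {set edge n}),
       [/\ (k < j)%N, B \in Clique n j & weight a (~: B) = 0]) ->
     (\int[P]_w T t k w)%E = +oo%E /\ (\int[P]_w L t k w)%E = +oo%E).
Proof.
have kn : (0 < k <= n)%N by rewrite k_gt0.
split=> [w_neq0|[j [B [kj BC wB]]]].
  have w_flat (B : {set edge n}) : flat k B -> weight a (~: B) != 0.
    by move=> /andP[BC kB]; exact: w_neq0 kB BC.
  split.
    rewrite (expectation_profile a_ge0 t_exp t_indep (phi := fun i => (k < i)%N%:R) (k := k))//.
    - congr EFin; apply: eq_bigr => j _; apply: eq_bigr => B _.
      by rewrite tauE.
    - by move=> i; rewrite leqNgt => /negPf->.
    - exact: measurable_T t_exp.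
    - by move=> w _; exact: T_integral.
  rewrite (expectation_profile a_ge0 t_exp t_indep (phi := fun i => (i - k)%N%:Z) (k := k))//.
  - congr EFin; apply: eq_bigr => j _; apply: eq_bigr => B _.
    by rewrite lambdaE.
  - by move=> i; rewrite -subn_eq0 => /eqP->.
  - exact: measurable_L t_exp.
  - by move=> w t_ge0; exact: L_integral.
have kB : (k < ncomp B)%N by rewrite (ncomp_Clique BC).
have too := times_infinite a_ge0 t_exp wB.
split; apply: integral_infinite.
- exact: measurable_T t_exp.
- by apply: filterS too => w; exact: T_infinite.
- exact: measurable_L t_exp.
- by apply: filterS2 (times_gt0 t_exp) too => w; exact: L_infinite.
Qed.
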